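(* Let $n\ge1$ and let $P\colon\mathbb{R}\to\mathbb{R}$ be a trigonometric polynomial $P(x)=a_0+\sum_{j=1}^n(a_j\cos(jx)+b_j\sin(jx))$ with real coefficients $a_0,\dots,a_n,b_1,\dots,b_n$. (i) One has $$\int_0^{2\pi}|P(x)|\,dx\ge4|a_n+ib_n|.$$ (ii) If $P$ (not identically zero) has $2n$ distinct zeroes $x_1,\dots,x_{2n}$ in $[0,2\pi)$, then $$\sum_{k=1}^{2n}\frac{1}{|P'(x_k)|}\ge\frac{2}{|a_n+ib_n|}.$$
   Context: Here $i$ is the imaginary unit, so $|a_n+ib_n|=\sqrt{a_n^2+b_n^2}$. *)

(* Defs.v *)
From Stdlib Require Import Reals.
From Coquelicot Require Import Coquelicot.
Open Scope R_scope.

(* Only [a 0], ..., [a n] and [b 1], ..., [b n] are relevant;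
   [sum_n_m u 1 n] is the sum of [u j] for [1 <= j <= n]. *)
Definition trig_poly (n : nat) (a b : nat -> R) (x : R) : R :=
  a 0%nat
  + sum_n_m (fun j : nat => a j * cos (INR j * x) + b j * sin (INR j * x)) 1 n.

(* Main.v *)
Require Import Defs.
From Stdlib Require Import Reals Lra Lia.
From Coquelicot Require Import Coquelicot.
From mathcomp Require all_boot all_order all_algebra complex Rstruct ring lra.
Open Scope R_scope.

(* Write R = |a_n + i b_n|.

   (i) In the alternating sum of the translates P(x + k pi/n), 1 <= k <= 2n, all
   frequencies below n cancel, and 2n R cos(n x - th) remains.  Cutting a period
   into 2n pieces of length pi/n bounds the integral of |P| from below by the integral
   of this function over an interval of length pi/n on which it is nonnegative, which
   is 4R.

   (ii) Let p be the polynomial of degree 2n with p(z) = 2 z^n P(x) for z = e^(ix).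
   It has the 2n distinct roots z_k = e^(i x_k), and evaluating at 0 the Lagrange
   interpolation formula for the constant 1 gives
   p(0) * sum_k 1 / (z_k p'(z_k)) = -1.
   Here p(0) = a_n + i b_n and |z_k p'(z_k)| = 2 |P'(x_k)|, so the triangle inequality
   finishes.  In particular R > 0. *)

(** * Finite sums with index starting at 1 *)

Lemma sum1_0 (f : nat -> R) : sum_n_m f 1 0 = 0.
Proof. exact (sum_n_m_zero f 1 0 (le_n 1)). Qed.

Lemma sum1_S (f : nat -> R) (K : nat) : sum_n_m f 1 (S K) = sum_n_m f 1 K + f (S K).
Proof. apply (sum_n_Sm f 1 K). lia. Qed.

Lemma sum1_plus (f g : nat -> R) (K : nat) :
  sum_n_m (fun k => f k + g k) 1 K = sum_n_m f 1 K + sum_n_m g 1 K.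
Proof. exact (sum_n_m_plus f g 1 K). Qed.

Lemma sum1_ext (f g : nat -> R) (K : nat) : (forall k, f k = g k) ->
  sum_n_m f 1 K = sum_n_m g 1 K.
Proof. exact (sum_n_m_ext f g 1 K). Qed.

Lemma sum1_mult_l (u : R) (f : nat -> R) (K : nat) :
  sum_n_m (fun k => u * f k) 1 K = u * sum_n_m f 1 K.
Proof. exact (sum_n_m_mult_l u f 1 K). Qed.

(** * Alternating sums over the translates by multiples of [PI / INR n] *)

(** Telescoping: [2 * sin (d / 2) * cos X = sin (X + d / 2) - sin (X - d / 2)]. *)
Lemma two_sin_half_mul_sum_cos (al d : R) (K : nat) :
  2 * sin (d / 2) * sum_n_m (fun k => cos (al + INR k * d)) 1 K
  = sin (al + (INR K + / 2) * d) - sin (al + / 2 * d).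
Proof.
induction K as [|K IH].
- rewrite sum1_0; simpl INR.
  replace ((0 + / 2) * d) with (/ 2 * d) by lra. lra.
- rewrite sum1_S.
  rewrite Rmult_plus_distr_l, IH, S_INR.
  replace (al + (INR K + 1 + / 2) * d) with ((al + (INR K + 1) * d) + d / 2) by field.
  replace (al + (INR K + / 2) * d) with ((al + (INR K + 1) * d) - d / 2) by field.
  set (X := al + (INR K + 1) * d).
  rewrite (sin_plus X), sin_minus. ring.
Qed.

Lemma cos_plus_INR_PI (y : R) (k : nat) : cos (y + INR k * PI) = (-1) ^ k * cos y.
Proof.
induction k as [|k IH].
- simpl. rewrite Rmult_0_l, Rplus_0_r. ring.
- rewrite S_INR.
  replace (y + (INR k + 1) * PI) with ((y + INR k * PI) + PI) by ring.
  rewrite neg_cos, IH. simpl. ring.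
Qed.

(** The sign [(-1) ^ k] is a phase shift by [k * PI], which turns frequency [j] into [j + n], with
    angle step [d]. The [2 * n] steps add up to [2 * (j + n) * PI], so the telescoped sum vanishes;
    [j < n] puts [d / 2] strictly between 0 and [PI], so its sine can be cancelled. *)
Lemma alternating_sum_cos (n j : nat) (al : R) : (j < n)%nat ->
  sum_n_m (fun k => (-1) ^ k * cos (al + INR j * (INR k * (PI / INR n)))) 1 (2 * n) = 0.
Proof.
intros hj.
assert (hn : 0 < INR n) by (apply lt_0_INR; lia).
pose proof PI_RGT_0 as hPI.
set (d := INR (j + n) * (PI / INR n)).
assert (hs : 0 < sin (d / 2)).
{ assert (0 < INR (j + n)) by (apply lt_0_INR; lia).
  assert (hlt : INR (j + n) < 2 * INR n)
    by (rewrite plus_INR; assert (INR j < INR n) by (apply lt_INR; lia); lra).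
  unfold d; apply sin_gt_0.
  - apply Rdiv_lt_0_compat; [|lra]. apply Rmult_lt_0_compat; [lra|].
    apply Rdiv_lt_0_compat; lra.
  - replace (INR (j + n) * (PI / INR n) / 2) with (PI * (INR (j + n) / (2 * INR n)))
      by (field; lra).
    rewrite <- (Rmult_1_r PI) at 2. apply Rmult_lt_compat_l; [lra|].
    apply Rlt_div_l; lra. }
rewrite (sum1_ext _ (fun k => cos (al + INR k * d))).
- apply Rmult_eq_reg_l with (2 * sin (d / 2)); [|lra].
  rewrite two_sin_half_mul_sum_cos, Rmult_0_r, mult_INR.
  replace (al + (INR 2 * INR n + / 2) * d)
    with (al + / 2 * d + 2 * INR (j + n) * PI) by (unfold d; simpl; field; lra).
  rewrite sin_period. ring.
- intros k. rewrite <- cos_plus_INR_PI. f_equal. unfold d; rewrite plus_INR. field. lra.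
Qed.

Lemma trig_poly_S (m : nat) (a b : nat -> R) (x : R) :
  trig_poly (S m) a b x =
  trig_poly m a b x + (a (S m) * cos (INR (S m) * x) + b (S m) * sin (INR (S m) * x)).
Proof.
unfold trig_poly. rewrite sum1_S. ring.
Qed.

Lemma trig_poly_0 (a b : nat -> R) (x : R) : trig_poly 0 a b x = a 0%nat.
Proof.
unfold trig_poly. rewrite sum1_0; simpl INR. ring.
Qed.

Lemma alternating_sum_harmonic (n j : nat) (u v x : R) : (j < n)%nat ->
  sum_n_m (fun k => (-1) ^ k * (u * cos (INR j * (x + INR k * (PI / INR n)))
                     + v * sin (INR j * (x + INR k * (PI / INR n))))) 1 (2 * n) = 0.
Proof.
(* The sine is a cosine with phase shifted by [- PI / 2]. *)
intros hj.
transitivity (u * sum_n_m (fun k =>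
    (-1) ^ k * cos (INR j * x + INR j * (INR k * (PI / INR n)))) 1 (2 * n)
  + v * sum_n_m (fun k =>
    (-1) ^ k * cos ((INR j * x - PI / 2) + INR j * (INR k * (PI / INR n)))) 1 (2 * n)).
- rewrite <- !sum1_mult_l, <- sum1_plus.
  apply sum1_ext; intros k.
  set (y := INR j * (x + INR k * (PI / INR n))).
  replace (INR j * x + INR j * (INR k * (PI / INR n))) with y by (unfold y; ring).
  replace (INR j * x - PI / 2 + INR j * (INR k * (PI / INR n))) with (y - PI / 2)
    by (unfold y; ring).
  rewrite cos_minus, cos_PI2, sin_PI2. simpl. ring.
- rewrite !alternating_sum_cos by exact hj.
  rewrite !Rmult_0_r. apply Rplus_0_r.
Qed.

Lemma alternating_sum_low_degree (n m : nat) (a b : nat -> R) (x : R) : (m < n)%nat ->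
  sum_n_m (fun k => (-1) ^ k * trig_poly m a b (x + INR k * (PI / INR n))) 1 (2 * n) = 0.
Proof.
induction m as [|m IH]; intros hm.
- rewrite <- (alternating_sum_harmonic n 0 (a 0%nat) 0 x hm).
  apply sum1_ext; intros k. rewrite trig_poly_0. simpl (INR 0).
  rewrite !Rmult_0_l, cos_0. ring.
(* The right-hand side is written as 0 + 0 and each 0 as a vanishing sum, which leaves a termwise
   identity. *)
- rewrite <- (Rplus_0_l 0), <- IH at 1 by lia.
  rewrite <- (alternating_sum_harmonic n (S m) (a (S m)) (b (S m)) x hm).
  rewrite <- sum1_plus.
  apply sum1_ext; intros k. rewrite trig_poly_S. ring.
Qed.

(* Frequencies below [n] cancel and frequency [n] is in phase with the signs. *)
Lemma alternating_sum_trig_poly (n : nat) (a b : nat -> R) (x : R) : (1 <= n)%nat ->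
  sum_n_m (fun k => (-1) ^ k * trig_poly n a b (x + INR k * (PI / INR n))) 1 (2 * n)
  = 2 * INR n * (a n * cos (INR n * x) + b n * sin (INR n * x)).
Proof.
destruct n as [|m]; [lia|intros _].
set (n := S m). assert (hn : INR n <> 0) by (apply not_0_INR; lia).
rewrite <- (Rplus_0_l (2 * _ * _)).
rewrite <- (alternating_sum_low_degree n m a b x) by lia.
transitivity (sum_n_m (fun k => (-1) ^ k * trig_poly m a b (x + INR k * (PI / INR n))) 1 (2 * n)
  + sum_n_m (fun _ => a n * cos (INR n * x) + b n * sin (INR n * x)) 1 (2 * n)).
- rewrite <- sum1_plus. apply sum1_ext; intros k.
  unfold n at 1; rewrite trig_poly_S; fold n.
  replace (INR n * (x + INR k * (PI / INR n))) with (INR n * x + INR k * PI) by (field; exact hn).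
  assert (hs : sin (INR n * x + INR k * PI) = (-1) ^ k * sin (INR n * x)).
  { pose proof (cos_plus_INR_PI (INR n * x - PI / 2) k) as h.
    replace (INR n * x - PI / 2 + INR k * PI) with ((INR n * x + INR k * PI) - PI / 2) in h by ring.
    rewrite !cos_minus, cos_PI2, sin_PI2 in h. lra. }
  rewrite hs, cos_plus_INR_PI.
  (* The sign from the sum meets the sign from the shift by [k * PI], so all [2 * n] terms of
     frequency [n] are equal. *)
  assert (h1 : (-1) ^ k * (-1) ^ k = 1).
  { rewrite <- Rpow_mult_distr. replace (-1 * -1) with 1 by ring. apply pow1. }
  set (e := (-1) ^ k) in *.
  transitivity (e * trig_poly m a b (x + INR k * (PI / INR n))
    + (e * e) * (a n * cos (INR n * x) + b n * sin (INR n * x))); [ring|].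
  rewrite h1. ring.
- rewrite sum_n_m_const. replace (S (2 * n) - 1)%nat with (2 * n)%nat by lia.
  rewrite mult_INR. simpl (INR 2). match goal with |- ?a = ?b => change (@eq R a b) end. ring.
Qed.

(** * Continuity, periodicity and subdivision of integrals *)

Lemma continuous_trig_poly (n : nat) (a b : nat -> R) (x : R) :
  continuous (trig_poly n a b) x.
Proof.
induction n as [|n IH].
- apply (continuous_ext (fun _ => a 0%nat)); [intros; symmetry; apply trig_poly_0|].
  apply continuous_const.
- eapply continuous_ext; [intros; symmetry; apply trig_poly_S|].
  apply (continuous_plus (V := R_NormedModule)); [exact IH|].
  apply (ex_derive_continuous (V := R_NormedModule)). auto_derive. trivial.
Qed.

Lemma trig_poly_periodic (n : nat) (a b : nat -> R) (x : R) :
  trig_poly n a b (x + 2 * PI) = trig_poly n a b x.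
Proof.
unfold trig_poly. f_equal. apply sum1_ext; intros j.
replace (INR j * (x + 2 * PI)) with (INR j * x + 2 * INR j * PI) by ring.
rewrite cos_period, sin_period. reflexivity.
Qed.

Lemma RInt_shift (f : R -> R) (s u v : R) : (forall x, continuous f x) ->
  RInt (fun x => f (x + s)) u v = RInt f (u + s) (v + s).
Proof.
intros hf.
pose proof (RInt_comp_lin f 1 s u v) as h.
rewrite !Rmult_1_l in h. rewrite <- h.
- apply RInt_ext; intros y _. unfold scal; simpl; unfold mult; simpl.
  rewrite !Rmult_1_l. reflexivity.
- apply (ex_RInt_continuous (V := R_CompleteNormedModule)). intros; apply hf.
Qed.

(** Cut at 0 and [T]: the piece from [T] to [t + T] is a translate of the one from 0 to [t], and
    cancels the oriented piece from [t] to 0. *)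
Lemma RInt_periodic (f : R -> R) (T t : R) : (forall x, continuous f x) ->
  (forall x, f (x + T) = f x) -> RInt f t (t + T) = RInt f 0 T.
Proof.
intros hf hT.
assert (hi : forall u v, ex_RInt f u v).
{ intros. apply (ex_RInt_continuous (V := R_CompleteNormedModule)); intros; apply hf. }
rewrite <- (RInt_Chasles f t 0 (t + T)), <- (RInt_Chasles f 0 T (t + T)) by apply hi.
assert (h : RInt f T (t + T) = RInt f 0 t).
{ rewrite <- (Rplus_0_l T) at 1. rewrite <- RInt_shift by exact hf.
  apply RInt_ext; intros; apply hT. }
rewrite h, <- (opp_RInt_swap f 0 t) by apply hi.
unfold plus, opp; simpl. ring.
Qed.

Lemma continuous_shift (f : R -> R) (s x : R) : (forall y, continuous f y) ->
  continuous (fun y => f (y + s)) x.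
Proof.
intros hf. apply (continuous_comp (fun y => y + s) f); [|apply hf].
apply (continuous_plus (V := R_NormedModule)); [apply continuous_id|apply continuous_const].
Qed.

Lemma continuous_sum1_shift (f : R -> R) (h x : R) (K : nat) : (forall y, continuous f y) ->
  continuous (fun x => sum_n_m (fun k => f (x + INR k * h)) 1 K) x.
Proof.
intros hf. induction K as [|K IH].
- apply (continuous_ext (fun _ => 0)); [|apply continuous_const].
  intros y. symmetry. apply sum1_0.
- eapply continuous_ext; [intros; symmetry; apply sum1_S|].
  apply (continuous_plus (V := R_NormedModule)); [exact IH|apply continuous_shift, hf].
Qed.

Lemma sum1_le (f g : nat -> R) (K : nat) : (forall k, f k <= g k) ->
  sum_n_m f 1 K <= sum_n_m g 1 K.
Proof. intros hfg. exact (sum_n_m_le f g 1 K hfg). Qed.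

(** The [k]-th summand contributes the integral of [f] from [t + k * h] to [t + (k + 1) * h]. As [k]
    starts at 1, the pieces begin at [t + h]. *)
Lemma RInt_subdivide (f : R -> R) (h t : R) (K : nat) : (forall x, continuous f x) ->
  RInt (fun x => sum_n_m (fun k => f (x + INR k * h)) 1 K) t (t + h)
  = RInt f (t + h) (t + h + INR K * h).
Proof.
intros hf.
assert (hi : forall u v, ex_RInt f u v).
{ intros. apply (ex_RInt_continuous (V := R_CompleteNormedModule)); intros; apply hf. }
induction K as [|K IH].
- rewrite Rmult_0_l, Rplus_0_r, RInt_point.
  rewrite (RInt_ext _ (fun _ => 0)).
  + rewrite RInt_const. unfold scal, zero; simpl; unfold mult; simpl. ring.
  + intros y _. apply sum1_0.
- rewrite (RInt_ext _ (fun x => sum_n_m (fun k => f (x + INR k * h)) 1 K + f (x + INR (S K) * h)))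
    by (intros; apply sum1_S).
  rewrite (RInt_plus (V := R_CompleteNormedModule))
    by (apply (ex_RInt_continuous (V := R_CompleteNormedModule)); intros;
        first [apply continuous_sum1_shift, hf|apply continuous_shift, hf]).
  rewrite IH, RInt_shift by exact hf.
  rewrite S_INR.
  replace (t + h + (INR K + 1) * h) with (t + h + INR K * h + h) by ring.
  replace (t + (INR K + 1) * h) with (t + h + INR K * h) by ring.
  apply RInt_Chasles; apply hi.
Qed.

(** * Amplitude and phase, and the lower bound for the integral *)

Lemma exists_phase (u v : R) :
  exists th, u * cos th + v * sin th = sqrt (u ^ 2 + v ^ 2).
Proof.
set (r := sqrt (u ^ 2 + v ^ 2)).
assert (hp : 0 <= u ^ 2 + v ^ 2) by nra.
assert (hr2 : r * r = u ^ 2 + v ^ 2) by (apply sqrt_sqrt; exact hp).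
destruct (Rle_lt_or_eq_dec 0 r (sqrt_pos _)) as [hr|hr].
- assert (hu : -1 <= u / r <= 1).
  { split; [apply Rle_div_r|apply Rle_div_l]; nra. }
  assert (hv : r * sqrt (1 - (u / r)²) = Rabs v).
  { rewrite <- (Rabs_pos_eq r) at 1 by lra.
    rewrite <- (sqrt_Rsqr_abs r), <- sqrt_mult_alt by apply Rle_0_sqr.
    rewrite <- sqrt_Rsqr_abs. f_equal. unfold Rsqr.
    transitivity (r * r - u ^ 2); [field; lra|]. rewrite hr2. ring. }
  (* [acos (u / r)] gives the right cosine; the sign [e] of [v] decides between this angle and its
     opposite. *)
  assert (hs : exists e, e * e = 1 /\ v = e * Rabs v).
  { destruct (Rle_dec 0 v).
    - exists 1. rewrite Rabs_pos_eq by lra. lra.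
    - exists (-1). rewrite Rabs_left by lra. lra. }
  destruct hs as [e [he hve]].
  assert (hth : exists th, cos th = u / r /\ sin th = e * sqrt (1 - (u / r)²)).
  { assert (e = 1 \/ e = -1) as [-> | ->].
    { destruct (Rmult_integral (e - 1) (e + 1)); [nra|left; lra|right; lra]. }
    - exists (acos (u / r)). rewrite cos_acos, sin_acos by exact hu. lra.
    - exists (- acos (u / r)). rewrite cos_neg, sin_neg, cos_acos, sin_acos by exact hu. lra. }
  destruct hth as [th [hc hsn]]. exists th.
  apply Rmult_eq_reg_l with r; [|lra].
  rewrite hr2, hc, hsn.
  transitivity (u ^ 2 + v * e * (r * sqrt (1 - (u / r)²))); [field; lra|].
  rewrite hv, Rmult_assoc, <- hve. ring.
- exists 0. rewrite <- hr in hr2 |- *. replace u with 0 by nra. replace v with 0 by nra. ring.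
Qed.

Lemma Cmod_eq_sqrt (u v : R) : Cmod (RtoC u + Ci * RtoC v)%C = sqrt (u ^ 2 + v ^ 2).
Proof. unfold Cmod; simpl. f_equal. ring. Qed.

Lemma RInt_abs_trig_poly_ge (n : nat) (a b : nat -> R) : (1 <= n)%nat ->
  4 * sqrt (a n ^ 2 + b n ^ 2) <= RInt (fun x => Rabs (trig_poly n a b x)) 0 (2 * PI).
Proof.
intros hn1.
assert (hn : 0 < INR n) by (apply lt_0_INR; lia).
pose proof PI_RGT_0 as hPI.
set (f := fun x => Rabs (trig_poly n a b x)).
assert (hf : forall x, continuous f x).
{ intros x. apply (continuous_comp (trig_poly n a b) Rabs).
  - apply continuous_trig_poly.
  - apply continuous_Rabs. }
destruct (exists_phase (a n) (b n)) as [th hth].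
(* With this [t], the phase [n * x - th] runs from [- PI / 2] to [PI / 2] on the interval from [t]
   to [t + h]: a full positive arch of the cosine. *)
set (h := PI / INR n). set (t := (th - PI / 2) / INR n).
assert (hh : INR n * h = PI) by (unfold h; field; lra).
assert (ht : INR n * t = th - PI / 2) by (unfold t; field; lra).
(* The period is made to start at [t + h] to match [RInt_subdivide]. *)
rewrite <- (RInt_periodic f (2 * PI) (t + h) hf).
2: { intros x. unfold f. rewrite trig_poly_periodic. reflexivity. }
replace (2 * PI) with (INR (2 * n) * h) by (rewrite mult_INR; simpl (INR 2); lra).
rewrite <- RInt_subdivide by exact hf.
set (g := fun x => 2 * INR n * (a n * cos (INR n * x) + b n * sin (INR n * x))).
assert (hg : is_RInt g t (t + h) (4 * sqrt (a n ^ 2 + b n ^ 2))).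
(* [G] is an antiderivative of [g]. Since [n * h = PI], [G (t + h) = - G t], and the choice of [t]
   makes [G t] equal to minus twice the amplitude. *)
{ set (G := fun x => 2 * (a n * sin (INR n * x) - b n * cos (INR n * x))).
  replace (4 * sqrt (a n ^ 2 + b n ^ 2)) with (minus (G (t + h)) (G t)).
  - apply (is_RInt_derive (V := R_CompleteNormedModule) G g); intros x _.
    + unfold G, g. auto_derive; [trivial|ring].
    + apply (ex_derive_continuous (V := R_NormedModule)). unfold g. auto_derive. trivial.
  - change (G (t + h) - G t = 4 * sqrt (a n ^ 2 + b n ^ 2)). unfold G.
    rewrite Rmult_plus_distr_l, hh, neg_sin, neg_cos, ht, cos_minus, sin_minus, cos_PI2, sin_PI2.
    rewrite <- hth. ring. }
rewrite <- (is_RInt_unique _ _ _ _ hg).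
assert (0 < h) by (apply Rdiv_lt_0_compat; lra).
apply RInt_le; [lra|exists (4 * sqrt (a n ^ 2 + b n ^ 2)); exact hg| |].
- apply (ex_RInt_continuous (V := R_CompleteNormedModule)); intros. apply continuous_sum1_shift, hf.
- intros x _. unfold g. rewrite <- alternating_sum_trig_poly by exact hn1.
  apply sum1_le; intros k. unfold f.
  apply Rle_trans with (1 := Rle_abs _).
  rewrite Rabs_mult, pow_1_abs, Rmult_1_l. apply Rle_refl.
Qed.

(** * The derivative, and angles determined by their cosine and sine *)

Lemma is_derive_trig_poly (n : nat) (a b : nat -> R) (x : R) :
  is_derive (trig_poly n a b) x
    (sum_n_m (fun j => INR j * (b j * cos (INR j * x) - a j * sin (INR j * x))) 1 n).
Proof.
induction n as [|n IH].
- rewrite sum1_0. apply (is_derive_ext (fun _ => a 0%nat)).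
  + intros; symmetry; apply trig_poly_0.
  + apply (is_derive_const (V := R_NormedModule)).
- rewrite sum1_S.
  eapply is_derive_ext; [intros; symmetry; apply trig_poly_S|].
  apply (is_derive_plus (V := R_NormedModule)); [exact IH|].
  generalize (INR (S n)); intros c. auto_derive; [trivial|ring].
Qed.

(** If [u < v] had equal cosines and sines, then [cos (v - u) = 1], so the sine of [(v - u) / 2]
    would vanish strictly between 0 and [PI]. This makes distinct zeroes give distinct points of the
    unit circle. *)
Lemma cos_sin_inj (x y : R) : 0 <= x < 2 * PI -> 0 <= y < 2 * PI ->
  cos x = cos y -> sin x = sin y -> x = y.
Proof.
assert (haux : forall u v, 0 <= u < 2 * PI -> 0 <= v < 2 * PI ->
  cos u = cos v -> sin u = sin v -> u < v -> False).
{ intros u v hu hv hc hs huv.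
  assert (h1 : cos (2 * ((v - u) / 2)) = 1).
  { replace (2 * ((v - u) / 2)) with (v - u) by field.
    rewrite cos_minus, hc, hs. pose proof (sin2_cos2 v). unfold Rsqr in *. lra. }
  assert (h2 : 0 < sin ((v - u) / 2)) by (apply sin_gt_0; lra).
  rewrite cos_2a_sin in h1. nra. }
intros hx hy hc hs.
destruct (Rtotal_order x y) as [h|[h|h]]; [exfalso; eauto|exact h|exfalso].
apply (haux y x); auto.
Qed.

(** * Lagrange interpolation at the roots of a polynomial *)

Module ComplexRoots.
Import all_boot all_order all_algebra complex Rstruct ring lra.
Import Order.TTheory GRing.Theory Num.Theory.
Local Open Scope ring_scope.
Local Delimit Scope R_scope with coqR.

(* Lagrange interpolation of the constant 1 at the roots, evaluated at 0.  That
   the roots are simple follows from their number. *)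
Lemma sum_inv_mul_deriv_roots (F : fieldType) (p : {poly F}) (s : seq F) :
  uniq s -> all (root p) s -> size p = (size s).+1 -> (0 < size s)%N -> 0 \notin s ->
  p.[0] * \sum_(z <- s) (z * (p^`()).[z])^-1 = -1.
Proof.
move=> us /allP rs sp s0 ns.
(* The cofactor [q z] vanishes at the other roots and equals [p'(z)] at [z]; divided by [p'(z)] it
   is the Lagrange basis polynomial. *)
pose q z : {poly F} := p %/ ('X - z%:P).
have pE z : z \in s -> p = q z * ('X - z%:P).
  by move=> zs; rewrite /q divpK // dvdp_XsubCl; exact: rs.
have sq z : z \in s -> size (q z) = size s.
  by move=> zs; rewrite size_divp ?polyXsubC_eq0 // size_XsubC sp subn1.
have dE z : z \in s -> (p^`()).[z] = (q z).[z].
  by move=> zs; rewrite {1}(pE z zs) derivM derivXsubC !hornerE subrr mulr0 add0r.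
have q0 z w : z \in s -> w \in s -> w != z -> (q z).[w] = 0.
  move=> zs ws wz; apply/eqP.
  move: (rs w ws); rewrite (pE z zs) rootM root_XsubC (negbTE wz) orbF.
  by rewrite rootE.
have qz0 z : z \in s -> q z != 0.
  by move=> zs; rewrite -size_poly_gt0 sq.
have d0 z : z \in s -> (p^`()).[z] != 0.
  (* A double root [z] would give the nonzero [q z] as many roots as its size, one more than its
     degree allows. *)
  move=> zs; rewrite dE //; apply/negP => qz.
  suff: (size s < size (q z))%N by rewrite sq // ltnn.
  apply: (max_poly_roots (qz0 z zs) _ us); apply/allP => w ws.
  by have [->|wz] := eqVneq w z; rewrite rootE // q0.
(* The interpolant of 1, minus 1: it vanishes on all of [s] but has size at most [size s], hence is
   zero. *)
pose L : {poly F} := \sum_(z <- s) (p^`()).[z]^-1 *: q z - 1.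
have L0 : L = 0.
  apply/eqP; apply: contraT => Ln0.
  suff: (size s < size L)%N.
    rewrite ltnNge => /negP[]; rewrite (leq_trans (size_polyD _ _)) // geq_max.
    rewrite size_polyN size_poly1 s0 andbT.
    apply: (leq_trans (size_sum _ _ _)).
    rewrite big_seq; apply/bigmax_leqP_seq => z zs _.
    by rewrite (leq_trans (size_scale_leq _ _)) ?sq.
  apply: (max_poly_roots Ln0 _ us); apply/allP => w ws.
  rewrite rootE /L hornerD hornerN hornerC horner_sum (bigD1_seq w) //=.
  rewrite hornerZ -dE // mulVf ?d0 //.
  rewrite big_seq_cond big1 ?addr0 ?subrr // => z /andP[zs wz].
  by rewrite hornerZ q0 ?mulr0 // eq_sym.
have : L.[0] = 0 by rewrite L0 horner0.
rewrite hornerD hornerN hornerC horner_sum => /eqP; rewrite subr_eq0 => /eqP L1.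
rewrite -L1 big_distrr /= -sumrN big_seq [RHS]big_seq; apply: eq_bigr => z zs.
have z0 : z != 0 by apply: contraNneq ns => <-.
(* This turns [(q z).[0] / p'(z)] into [- p(0) / (z p'(z))]. *)
have -> : p.[0] = (q z).[0] * (- z) by rewrite {1}(pE z zs) !hornerE.
by rewrite hornerZ invfM mulrN mulNr mulrA mulfK // [_.[0] * _]mulrC.
Qed.

(** * The algebraic polynomial attached to a trigonometric polynomial *)

Local Open Scope complex_scope.

(* The term [j = 0] contributes [2 * a 0], whatever [b 0] is. *)
Definition trig_coef_poly (n m : nat) (a b : nat -> R) : {poly R[i]} :=
  \sum_(0 <= j < m.+1) ((a j -i* b j) *: 'X^(n + j) + (a j +i* b j) *: 'X^(n - j)).

Definition expi (x : R) : R[i] := cos x +i* sin x.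

Lemma cos_sqr_add_sin_sqr (x : R) : cos x ^+ 2 + sin x ^+ 2 = 1.
Proof. by have := sin2_cos2 x; rewrite /Rsqr !RealsE addrC !expr2. Qed.

Lemma expi_exp (x : R) (k : nat) : expi x ^+ k = expi (INR k * x).
Proof.
elim: k => [|k IH].
  by rewrite expr0 /expi Rmult_0_l cos_0 sin_0.
rewrite exprS IH /expi.
have -> : Rmult (INR k.+1) x = Rplus x (Rmult (INR k) x) by rewrite S_INR !RealsE; ring.
rewrite cos_plus sin_plus; simpc; rewrite !RealsE; congr (_ +i* _); ring.
Qed.

(** On the unit circle the inverse of [expi x ^+ j] is its conjugate. *)
Lemma expi_sub (x : R) (n j : nat) : (j <= n)%N ->
  expi x ^+ (n - j) = expi x ^+ n * (cos (INR j * x) -i* sin (INR j * x)).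
Proof.
move=> jn; rewrite -{2}(subnK jn) exprD -mulrA [expi x ^+ j]expi_exp /expi.
set c := cos (INR j * x); set d := sin (INR j * x).
have -> : (c +i* d) * (c -i* d) = 1.
  simpc; congr (_ +i* _); last by ring.
  by rewrite -(cos_sqr_add_sin_sqr (INR j * x)) -/c -/d; ring.
by rewrite mulr1.
Qed.

(** After factoring out [expi x ^+ n], the two terms are complex conjugates and add up to twice a
    real part. *)
Lemma horner_harmonic (x u v : R) (n j : nat) : (j <= n)%N ->
  ((u -i* v) *: 'X^(n + j) + (u +i* v) *: 'X^(n - j)).[expi x]
  = expi x ^+ n * (2 * (u * cos (INR j * x) + v * sin (INR j * x)))%:C.
Proof.
move=> jn; rewrite !hornerE exprD expi_sub // mulrCA [X in _ + X]mulrCA -mulrDr.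
congr (_ * _); rewrite expi_exp /expi; simpc; congr (_ +i* _); ring.
Qed.

(** On the unit circle [z * d/dz] is [-i * d/dx]. Applied to [2 * expi x ^+ n * H(x)], with [H] the
    harmonic, it gives [expi x ^+ n * (2 * n * H - 2 * i * H')]. *)
Lemma horner_deriv_harmonic (x u v : R) (n j : nat) : (j <= n)%N ->
  expi x * (((u -i* v) *: 'X^(n + j) + (u +i* v) *: 'X^(n - j))^`()).[expi x]
  = expi x ^+ n * (2 * (INR n * (u * cos (INR j * x) + v * sin (INR j * x)))
      -i* (2 * (INR j * (v * cos (INR j * x) - u * sin (INR j * x))))).
Proof.
move=> jn.
have dX m : expi x * (('X^m)^`()).[expi x] = (INR m)%:C * expi x ^+ m.
  rewrite derivXn hornerMn hornerXn !RealsE rmorph_nat mulr_natl.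
  by case: m => [|m]; rewrite ?mulr0n ?mulr0 // mulrnAr -exprS.
rewrite derivD !derivZ hornerD !hornerZ mulrDr mulrCA dX [X in _ + X]mulrCA dX.
rewrite exprD expi_sub // [expi x ^+ j]expi_exp.
have -> : INR (n + j) = INR n + INR j by rewrite !RealsE natrD.
have -> : INR (n - j) = INR n - INR j by rewrite !RealsE natrB.
set e := expi x ^+ n; rewrite /expi.
set c := cos (INR j * x); set d := sin (INR j * x).
transitivity (e * ((u -i* v) * ((INR n + INR j)%:C * (c +i* d))
    + (u +i* v) * ((INR n - INR j)%:C * (c -i* d)))); first by ring.
congr (_ * _); simpc; congr (_ +i* _); ring.
Qed.

(** Keeping the shift [n] apart from the degree [m] allows induction on [m] with the factor
    [expi x ^+ n] fixed. *)
Lemma horner_trig_coef_poly (x : R) (a b : nat -> R) (n m : nat) : (m <= n)%N ->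
  (trig_coef_poly n m a b).[expi x] = expi x ^+ n * (2 * trig_poly m a b x)%:C.
Proof.
elim: m => [|m IH] mn; rewrite /trig_coef_poly big_nat_recr //= hornerD horner_harmonic //.
  rewrite big_geq // horner0 add0r trig_poly_0.
  by rewrite Rmult_0_l cos_0 sin_0 mulr1 mulr0 addr0.
by rewrite [X in X + _]IH 1?ltnW // trig_poly_S -mulrDr -rmorphD -mulrDr !RealsE.
Qed.

Lemma horner_deriv_trig_coef_poly (x : R) (a b : nat -> R) (n m : nat) : (m <= n)%N ->
  expi x * ((trig_coef_poly n m a b)^`()).[expi x]
  = expi x ^+ n * (2 * (INR n * trig_poly m a b x) -i* (2 * Derive (trig_poly m a b) x)).
Proof.
have DE k := is_derive_unique _ _ _ (is_derive_trig_poly k a b x).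
elim: m => [|m IH] mn; rewrite DE /trig_coef_poly big_nat_recr //= derivD hornerD mulrDr
  horner_deriv_harmonic //.
  rewrite big_geq // deriv0 horner0 mulr0 add0r trig_poly_0 sum1_0.
  by rewrite Rmult_0_l cos_0 sin_0 mul0r mulr1 !RealsE !mulr0 addr0.
rewrite [X in X + _]IH 1?ltnW // DE trig_poly_S sum1_S -mulrDr; congr (_ * _).
simpc; rewrite !RealsE;  congr (_ +i* _); ring.
Qed.
(** Only a bound, since the top coefficient [a n -i* b n] is not yet known to be nonzero when
    [m = n]; equality will come from counting roots. *)
Lemma size_trig_coef_poly (n m : nat) (a b : nat -> R) : (m <= n)%N ->
  (size (trig_coef_poly n m a b) <= (2 * n).+1)%N.
Proof.
move=> mn; rewrite /trig_coef_poly big_mkord (leq_trans (size_sum _ _ _)) //.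
apply/bigmax_leqP => j _; have jn : (j <= n)%N by rewrite (leq_trans _ mn) // -ltnS.
rewrite (leq_trans (size_polyD _ _)) // geq_max !(leq_trans (size_scale_leq _ _)) //.
  by rewrite size_polyXn ltnS (leq_trans (leq_subr _ _)) // leq_pmull.
by rewrite size_polyXn ltnS mul2n -addnn leq_add2l.
Qed.

Lemma horner0_trig_coef_poly (n : nat) (a b : nat -> R) : (0 < n)%N ->
  (trig_coef_poly n n a b).[0] = a n +i* b n.
Proof.
move=> n0; rewrite /trig_coef_poly big_nat_recr //= hornerD horner_sum big_nat big1 => [|j].
  rewrite !hornerE subnn /= expr0n addn_eq0 eqn0Ngt n0 /=. by rewrite mulr0 mulr1 !add0r.
move=> /= jn; rewrite !hornerE /= !expr0n addn_eq0 subn_eq0 leqNgt jn.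
by rewrite eqn0Ngt n0 !mulr0 addr0.
Qed.

Lemma norm_expi (x : R) : `|expi x| = 1.
Proof. by rewrite normc_def /= cos_sqr_add_sin_sqr sqrtr1. Qed.

Lemma sum1_iota (f : nat -> R) (K : nat) : sum_n_m f 1 K = \sum_(k <- iota 1 K) f k.
Proof.
elim: K => [|K IH]; first by rewrite sum1_0 big_nil.
have -> : iota 1 K.+1 = iota 1 K ++ [:: K.+1] by rewrite -[K.+1]addn1 iotaD add1n addn1.
by rewrite sum1_S IH big_cat big_seq1 !RealsE.
Qed.

(** * The lower bound for the sum of inverse derivatives *)

Lemma sum_inv_Derive_ge (n : nat) (a b x : nat -> R) : (0 < n)%N ->
  (exists y, trig_poly n a b y <> 0) ->
  {in iota 1 (2 * n), forall k, trig_poly n a b (x k) = 0} ->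
  {in iota 1 (2 * n) &, injective (fun k => expi (x k))} ->
  2 <= Num.sqrt (a n ^+ 2 + b n ^+ 2) *
       \sum_(k <- iota 1 (2 * n)) (`|Derive (trig_poly n a b) (x k)|)^-1.
Proof.
move=> n0 [y Py] Px injx.
set p := trig_coef_poly n n a b; set s := [seq expi (x k) | k <- iota 1 (2 * n)].
have expi0 t : expi t != 0 by rewrite -normr_gt0 norm_expi.
have p0 : p != 0.
  apply: contra_notN Py => /eqP p0.
  have /eqP := horner_trig_coef_poly y a b n n (leqnn n).
  rewrite -/p p0 horner0 eq_sym mulf_eq0 expf_eq0 (negbTE (expi0 _)) andbF /=.
  by rewrite fmorph_eq0 mulf_eq0 pnatr_eq0 => /eqP.
have us : uniq s by rewrite map_inj_in_uniq // iota_uniq.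
have rs : all (root p) s.
  apply/allP => _ /mapP[k ks ->].
  by rewrite rootE horner_trig_coef_poly // Px // mulr0 mulr0.
have ss : size s = (2 * n)%N by rewrite size_map size_iota.
(* The [2 * n] distinct roots of the nonzero [p] force its degree to be exactly [2 * n]. *)
have sp : size p = (size s).+1.
  apply/eqP; rewrite eqn_leq (max_poly_roots p0 rs us) andbT ss.
  exact: size_trig_coef_poly.
have s0 : (0 < size s)%N by rewrite ss muln_gt0.
have ns : 0 \notin s by apply/mapP => -[k _ /esym/eqP]; rewrite (negbTE (expi0 _)).
pose S : R[i] := \sum_(k <- iota 1 (2 * n)) (expi (x k) * (p^`()).[expi (x k)])^-1.
have E : (a n +i* b n) * S = -1.
  rewrite -horner0_trig_coef_poly //.
  by have := sum_inv_mul_deriv_roots _ _ _ us rs sp s0 ns; rewrite big_map.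
(* Triangle inequality; at a zero of the trigonometric polynomial, [z * p'(z)] has modulus twice
   that of the derivative. *)
have lS : `|S| <= (2^-1 * \sum_(k <- iota 1 (2 * n)) (`|Derive (trig_poly n a b) (x k)|)^-1)%:C.
  apply: le_trans (ler_norm_sum _ _ _) _.
  rewrite mulr_sumr rmorph_sum big_seq [X in _ <= X]big_seq; apply: ler_sum => k ks.
  rewrite horner_deriv_trig_coef_poly // Px //.
  rewrite normfV normrM normrX norm_expi expr1n mul1r normc_def /= !mulr0 expr0n add0r.
  by rewrite sqrrN sqrtr_sqr normrM normr_nat -invfM -fmorphV.
have := ler_wpM2l (normr_ge0 (a n +i* b n)) lS.
rewrite -normrM E normrN1 normc_def /= -rmorphM lecR => h.
lra.
Qed.

Lemma sum_inv_Derive_ge_sum1 (n : nat) (a b x : nat -> R) : (1 <= n)%coq_nat ->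
  (exists y, trig_poly n a b y <> 0) ->
  (forall k, (1 <= k /\ k <= 2 * n)%coq_nat ->
     (0 <= x k < 2 * PI)%coqR /\ trig_poly n a b (x k) = 0) ->
  (forall j k, (1 <= j /\ j <= 2 * n)%coq_nat -> (1 <= k /\ k <= 2 * n)%coq_nat ->
     j <> k -> x j <> x k) ->
  (2 <= sqrt (a n ^ 2 + b n ^ 2) *
        sum_n_m (fun k => 1 / Rabs (Derive (trig_poly n a b) (x k))) 1 (2 * n)%coq_nat)%coqR.
Proof.
move=> /ssrnat.leP n0 Py Px injx.
have in_iota (k : nat) : k \in iota 1 (2 * n) -> (1 <= k /\ k <= 2 * n)%coq_nat.
  by rewrite mem_iota add1n ltnS => /andP[/ssrnat.leP ? /ssrnat.leP].
apply/RleP; rewrite sum1_iota !RealsE.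
under eq_bigr do rewrite !RealsE mul1r.
apply: sum_inv_Derive_ge => //.
  by move=> k /in_iota /Px[].
move=> j k /in_iota jn /in_iota kn [ec es]; apply/eqP; apply: contraT => /eqP jk.
case: (injx _ _ jn kn jk); apply: cos_sin_inj => //; [exact: (Px _ jn).1 | exact: (Px _ kn).1].
Qed.

End ComplexRoots.

Theorem lemma1p14 (n : nat) (hn : (1 <= n)%nat) (a b : nat -> R) :
  RInt (fun x : R => Rabs (trig_poly n a b x)) 0 (2 * PI)
    >= 4 * Cmod (RtoC (a n) + Ci * RtoC (b n))%C
  /\
  ((exists y : R, trig_poly n a b y <> 0) ->
   forall x : nat -> R,
     (forall k : nat, (1 <= k <= 2 * n)%nat ->
        0 <= x k < 2 * PI /\ trig_poly n a b (x k) = 0) ->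
     (forall j k : nat, (1 <= j <= 2 * n)%nat -> (1 <= k <= 2 * n)%nat ->
        j <> k -> x j <> x k) ->
     sum_n_m (fun k : nat => 1 / Rabs (Derive (trig_poly n a b) (x k))) 1 (2 * n)
       >= 2 / Cmod (RtoC (a n) + Ci * RtoC (b n))%C).
Proof.
rewrite Cmod_eq_sqrt. split.
- apply Rle_ge, RInt_abs_trig_poly_ge, hn.
- intros hP x hx hinj.
  pose proof (ComplexRoots.sum_inv_Derive_ge_sum1 n a b x hn hP hx hinj) as h.
  set (r := sqrt (a n ^ 2 + b n ^ 2)) in *.
  (* If [r] were 0, the product inequality [h] would read [2 <= 0]. *)
  assert (hr : 0 < r).
  { destruct (Rle_lt_or_eq_dec 0 r (sqrt_pos _)) as [hr|hr]; [exact hr|].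
    rewrite <- hr, Rmult_0_l in h. lra. }
  apply Rle_ge, Rle_div_l; [exact hr|]. rewrite Rmult_comm. exact h.
Qed.
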